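(* Let $E$ be an infinite-dimensional Banach space over $\mathbb{R}$ or $\mathbb{C}$. Then there exists a measurable family $(x_t)_{t\in(0,1)}$ of vectors of $E$ which is linearly independent, so that the set $\{x_t : t\in(0,1)\}$ has the cardinality of the continuum (in particular is uncountable).
   Context: The interval $(0,1)\subset\mathbb{R}$ and the Banach space $E$ carry their Borel $\sigma$-algebras (generated by the open sets, norm-open in the case of $E$). A family $(x_t)_{t\in(0,1)}$ in $E$ is called measurable if the map $x:(0,1)\to E$, $t\mapsto x_t$, is measurable and its range $\{x_t : t\in(0,1)\}$ is a measurable (Borel) subset of $E$. Linear independence of the family is over the scalar field of $E$ and means that for pairwise distinct indices $t_1,\dots,t_n\in(0,1)$ the vectors $x_{t_1},\dots,x_{t_n}$ are linearly independent; in particular $t\mapsto x_t$ is injective. *)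

(* Defs.v *)
From HB Require Import structures.
From mathcomp Require Import all_boot all_order all_algebra.
From mathcomp Require Import all_classical all_reals all_analysis.
From mathcomp Require Import complex.

Set Implicit Arguments.
Unset Strict Implicit.
Unset Printing Implicit Defensive.

Import Order.TTheory GRing.Theory Num.Theory.
Import numFieldNormedType.Exports.

Local Open Scope classical_set_scope.
Local Open Scope ring_scope.

Definition finite_dimensional (K : numFieldType) (E : lmodType K) : Prop :=
  exists (n : nat) (e : 'I_n -> E),
    forall v : E, exists c : 'I_n -> K, v = \sum_(i < n) c i *: e i.

Definition infinite_dimensional (K : numFieldType) (E : lmodType K) : Prop :=
  ~ finite_dimensional E.

(* The family (x_t)_{t in (0,1)} is the restriction to (0,1) of a total map
   x : R -> E; its values outside (0,1) are irrelevant. *)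
Definition family_range (R : realType) (T : Type) (x : R -> T) : set T :=
  x @` `]0, 1[.

Definition borel (T : ptopologicalType) : measurableType _ :=
  g_sigma_algebraType (@open T).

Definition measurable_family (R : realType) (K : numFieldType)
    (E : normedModType K) (x : R -> E) : Prop :=
  measurable_fun (`]0, 1[ : set R) (x : R -> borel E) /\
  measurable (family_range x : set (borel E)).

Definition linearly_independent_family (R : realType) (K : numFieldType)
    (E : lmodType K) (x : R -> E) : Prop :=
  forall (n : nat) (t : 'I_n -> R),
    (forall i, t i \in `]0, 1[) -> injective t ->
  forall c : 'I_n -> K,
    \sum_(i < n) c i *: x (t i) = 0 -> forall i, c i = 0.

(* Main.v *)
Require Import Defs.
From HB Require Import structures.
From mathcomp Require Import all_boot all_order all_algebra.
From mathcomp Require Import all_classical all_reals all_analysis.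
From mathcomp Require Import complex.
From mathcomp Require Import measurable_realfun ring.

Set Implicit Arguments.
Unset Strict Implicit.
Unset Printing Implicit Defensive.

Import Order.TTheory GRing.Theory Num.Theory.
Import numFieldNormedType.Exports.

Local Open Scope classical_set_scope.
Local Open Scope ring_scope.
Local Open Scope complex_scope.

(** Let l^oo be the space of bounded scalar sequences. The family is the image
    of a curve of power sequences under an injective bounded linear map from
    l^oo to E.

    The map. Finite-dimensional subspaces of E are closed, because the scalars
    are complete, and they are proper because E is infinite-dimensional. Riesz's
    lemma therefore gives, one after the other, vectors e_n of norm 1 at
    distance at least 1/2 from the span of e_0, ..., e_(n-1); in other words
    the last coefficient of a combination is controlled by the whole:
    |b_n| <= 2 |b_0 e_0 + ... + b_n e_n| ([riesz_sequence]). Put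
    T b = sum_k b_k 16^-k e_k ([synthesis]). If T b = 0 and |b_k| <= B for all
    k, then b_0 e_0 + ... + b_n 16^-n e_n is minus the tail of the series, of
    norm at most 2 B 16^-(n+1), so |b_n| 16^-n <= 4 B 16^-(n+1) <= (B/2) 16^-n.
    The bound B has been halved; iterating, b = 0 ([synthesis_inj]).

    The curve. For t in [0,1] let x_t = T((t/2)^k)_k. Power sequences of
    distinct ratios are linearly independent, by the Vandermonde determinant,
    and T is injective, so the x_t are linearly independent
    ([power_curve_free]). On the disk of radius 1/2 each z |-> z^k is
    1-Lipschitz, so t |-> x_t is Lipschitz ([power_curve_lipschitz]).

    Measurability and cardinality. The family over (0,1) is a continuous
    injective arc; its range is the compact set x([0,1]) minus its two
    end points, hence Borel, and it is in bijection with (0,1)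
    ([arc_measurable_family]).

    The real and the complex case are treated at once, over a field K that
    contains R, has its norm values in R, and is sequentially complete
    ([complete_scalars]). *)

(** * Scalar fields over the reals *)

(** What the real and the complex numbers have in common here. The norm of K
    takes its values in K, so the second field is what gives access to the
    archimedean order of R. *)
Record complete_scalars (R : realType) (K : numFieldType)
    (iota : {rmorphism R -> K}) : Prop := {
  scalars_norm : forall r, `|iota r| = iota `|r|;
  scalars_ge0 : forall k : K, 0 <= k -> exists r, k = iota r;
  scalars_complete : forall u : nat -> K, cauchy (u @ \oo) -> cvg (u @ \oo) }.

Lemma scalars_le (R : realType) (K : numFieldType) (iota : {rmorphism R -> K})
  (H : complete_scalars iota) : {mono iota : r s / r <= s}.
Proof.
have iota_ge0 r : (0 <= iota r) = (0 <= r).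
  apply/idP/idP => [|r0]; last by rewrite -(ger0_norm r0) -scalars_norm.
  move=> /ger0_norm; rewrite scalars_norm// => /fmorph_inj <-.
  exact: normr_ge0.
by move=> r s; rewrite -subr_ge0 -rmorphB iota_ge0 subr_ge0.
Qed.

Lemma scalars_lt (R : realType) (K : numFieldType) (iota : {rmorphism R -> K})
  (H : complete_scalars iota) : {mono iota : r s / r < s}.
Proof. exact: leW_mono (scalars_le H). Qed.

Lemma half_expn_near (R : realType) (K : numFieldType)
    (iota : {rmorphism R -> K}) (H : complete_scalars iota) (e : K) :
  0 < e -> \forall n \near \oo, 2^-1 ^+ n < e.
Proof.
move=> e0; have [r er] := scalars_ge0 H (ltW e0).
have r0 : 0 < r by rewrite -(scalars_lt H) rmorph0 -er.
have h : `|2^-1 : R| < 1 by rewrite ger0_norm ?invr_ge0// invf_lt1// ltr1n.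
have /cvgr0_norm_lt/(_ r r0) := cvg_expr h.
apply: filterS => n /=; rewrite ger0_norm ?exprn_ge0 ?invr_ge0// => nr.
by rewrite er -(rmorph_nat iota) -fmorphV -rmorphXn (scalars_lt H).
Qed.

(** * Finite-dimensional subspaces are closed *)

(** The linear span, by recursion on the list of generators: adding one vector
    at a time is the induction used for closedness and in Riesz's lemma. *)
Fixpoint lspan (K : numFieldType) (E : lmodType K) (s : seq E) : set E :=
  if s is x :: s' then
    [set z | exists (a : K) (y : E), lspan s' y /\ z = a *: x + y]
  else [set 0].

Lemma lspan0 (K : numFieldType) (E : lmodType K) (s : seq E) : lspan s 0.
Proof.
by elim: s => //= x s IH; exists 0, 0; split => //; rewrite scale0r addr0.
Qed.

Lemma lspan_linear (K : numFieldType) (E : lmodType K) (s : seq E) (a : K)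
  (y z : E) : lspan s y -> lspan s z -> lspan s (a *: y + z).
Proof.
elim: s y z => [|x s IH] y z /=; first by move=> -> ->; rewrite scaler0 addr0.
move=> [b [y' [sy ->]]] [c [z' [sz ->]]].
exists (a * b + c), (a *: y' + z'); split; first exact: IH.
by rewrite scalerDr scalerDl scalerA addrACA.
Qed.

Lemma lspanZ (K : numFieldType) (E : lmodType K) (s : seq E) (a : K) (y : E) :
  lspan s y -> lspan s (a *: y).
Proof. by move=> sy; rewrite -[_ *: _]addr0; apply: lspan_linear (lspan0 s). Qed.

Lemma lspanB (K : numFieldType) (E : lmodType K) (s : seq E) (y z : E) :
  lspan s y -> lspan s z -> lspan s (y - z).
Proof.
by move=> sy sz; rewrite addrC -scaleN1r; exact: lspan_linear.
Qed.

Lemma lspan_sum (K : numFieldType) (E : lmodType K) (s : seq E) (z : E) :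
  lspan s z -> exists c : 'I_(size s) -> K, z = \sum_(i < size s) c i *: s`_i.
Proof.
elim: s z => [|x s IH] z /=.
  by move=> ->; exists (fun=> 0); rewrite big_ord0.
move=> [a [y [/IH[c ->] ->]]].
exists (fun i => if unlift ord0 i is Some j then c j else a).
rewrite big_ord_recl unlift_none; congr +%R.
by apply: eq_bigr => i _; rewrite liftK.
Qed.

Lemma lspan_neqT (K : numFieldType) (E : lmodType K) (s : seq E) :
  infinite_dimensional E -> exists y, ~ lspan s y.
Proof.
move=> infE; apply: contrapT => nex; apply: infE.
exists (size s), (fun i => s`_i) => v; apply: lspan_sum.
by apply: contrapT => sv; apply: nex; exists v.
Qed.

Lemma closed_dist_gt0 (K : numFieldType) (E : normedModType K) (F : set E) y :
  closed F -> ~ F y ->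
  exists2 d : K, 0 < d & forall f, F f -> d <= `|y - f|.
Proof.
move=> /closed_openC cF Fy.
have /nbhs_ballP[d /= d0 dF] : nbhs y (~` F) by exact: open_nbhs_nbhs.
exists d => // f Ff; rewrite real_leNgt ?normr_real ?gtr0_real//.
by apply/negP => yf; apply: dF Ff; rewrite -ball_normE.
Qed.

Lemma closure_approx (K : numFieldType) (E : normedModType K) (F : set E) y :
  closure F y <-> forall e : K, 0 < e -> exists2 f, F f & `|y - f| < e.
Proof.
split=> [cF e e0|h B /nbhs_ballP[e /= e0 eB]].
  have [f [Ff]] := cF _ (nbhsx_ballx y e e0).
  by rewrite -ball_normE => ?; exists f.
by have [f Ff yf] := h e e0; exists f; split => //; apply: eB; rewrite -ball_normE.
Qed.

(** Let x be outside the closed subspace F and at distance d > 0 from it. Then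
    d |a| <= |a x + f| for f in F, so the x-coordinate is continuous: when
    a_n x + f_n converges, the a_n form a Cauchy sequence. Their limit a exists
    by completeness of the scalars, and f_n converges to a vector of F. *)
Lemma closed_lspan (R : realType) (K : numFieldType)
    (iota : {rmorphism R -> K}) (H : complete_scalars iota)
    (E : normedModType K) (s : seq E) : closed (lspan s).
Proof.
elim: s => [|x s IH] /=.
  exact: accessible_closed_set1 (hausdorff_accessible (@norm_hausdorff _ E)) _.
have [sx|nsx] := pselect (lspan s x).
  rewrite (_ : [set _ | _] = lspan s)//; apply/seteqP; split => y /=.
    by move=> [a [z [sz ->]]]; exact: lspan_linear.
  by move=> sy; exists 0, y; split => //; rewrite scale0r add0r.
have [d d0 dP] := closed_dist_gt0 IH nsx.
have coef a y : lspan s y -> d * `|a| <= `|a *: x + y|.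
  move=> sy; have [->|a0] := eqVneq a 0; first by rewrite normr0 mulr0.
  rewrite mulrC -ler_pdivlMl ?normr_gt0// -normfV -normrZ scalerDr scalerA.
  rewrite mulVf// scale1r -[_ *: y]opprK; apply: dP.
  by rewrite -scaleNr; exact: lspanZ.
move=> y /closure_approx yP.
have /choice[f fP] n : exists p : K * E,
    lspan s p.2 /\ `|y - (p.1 *: x + p.2)| < 2^-1 ^+ n.
  have [|_ [a [z [sz ->]]] yz] := yP (2^-1 ^+ n); first by rewrite exprn_gt0.
  by exists (a, z).
have cvgf : cvg (fst \o f @ \oo).
  apply: (scalars_complete H); apply/cauchyP => e e0.
  have de : 0 < d * e / 2 by rewrite divr_gt0 // mulr_gt0.
  have [N _ NP] := half_expn_near H de.
  exists (f N).1; exists N => // n /= Nn; rewrite -ball_normE /=.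
  rewrite -(ltr_pM2l d0).
  apply: le_lt_trans (coef _ ((f N).2 - (f n).2) _) _.
    by apply: lspanB; [exact: (fP N).1 | exact: (fP n).1].
  rewrite [X in `|X|](_ : _ = (y - ((f n).1 *: x + (f n).2))
     - (y - ((f N).1 *: x + (f N).2))); last first.
    by rewrite opprB (addrC (_ - _)) subrKA scalerBl opprD addrACA.
  rewrite (splitr (d * e)); apply: le_lt_trans (ler_normB _ _) _.
  by apply: ltrD; apply: lt_trans (fP _).2 (NP _ _) => /=.
pose a := lim (fst \o f @ \oo).
suff sya : lspan s (y - a *: x) 
  by exists a, (y - a *: x); split => //; rewrite addrC subrK.
apply: IH; apply/closure_approx => e e0.
have e2 : 0 < e / 2 by rewrite divr_gt0.
have ax : (fst \o f) n *: x @[n --> \oo] --> a *: x by apply: cvgZr_tmp.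
move/cvgrPdist_lt : ax => /(_ _ e2) h1.
have h2 := half_expn_near H e2.
have [n [h1n h2n]] := filter_ex (filterI h1 h2).
exists (f n).2; first exact: (fP n).1.
have telescope (u v w z : E) : u - v - w = u - (z + w) - (v - z).
  by rewrite opprB opprD -[RHS]addrA [in RHS](addrC (- z - w)) [in RHS]addrACA
    subrr add0r addrA.
rewrite (telescope _ _ _ ((f n).1 *: x)).
rewrite (splitr e); apply: le_lt_trans (ler_normB _ _) _.
by apply: ltrD => //; exact: lt_trans (fP n).2 h2n.
Qed.

(** * Riesz's lemma and an almost orthogonal sequence *)

(** Normalize y - z, for z in F with |y - z| less than twice a lower bound of
    the distances |y - f|. Such a z exists because a positive lower bound cannot
    be doubled for ever. *)
Lemma riesz_lemma (R : realType) (K : numFieldType)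
    (iota : {rmorphism R -> K}) (H : complete_scalars iota)
    (E : normedModType K) (F : set E) (y : E) :
  closed F -> F 0 -> (forall a u v, F u -> F v -> F (a *: u + v)) -> ~ F y ->
  exists2 e, `|e| = 1 & forall f, F f -> 1 <= 2 * `|e - f|.
Proof.
move=> cF F0 Flin /(closed_dist_gt0 cF)[d d0 dP].
pose P j := forall f, F f -> d * 2 ^+ j <= `|y - f|.
(* Multiply the lower bound d by the largest possible power of 2. *)
have [j [Pj nPj]] : exists j, P j /\ ~ P j.+1.
  apply: contrapT => nex.
  have allP j : P j.
    elim: j => [f Ff|j IH]; first by rewrite mulr1 dP.
    by apply: contrapT => nP; apply: nex; exists j.
  have y1 : 0 < `|y| + 1 by rewrite ltr_wpDl.
  have [n] := filter_ex (half_expn_near H (divr_gt0 d0 y1)).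
  rewrite exprVn ltr_pdivlMr// mulrC ltr_pdivrMr ?exprn_gt0// => yd.
  have := allP n 0 F0; rewrite subr0 => /(lt_le_trans yd).
  by rewrite gtrDl ltr10.
have [z [Fz yz]] : exists z, F z /\ `|y - z| < d * 2 ^+ j.+1.
  apply: contrapT => nex; apply: nPj => f Ff.
  rewrite real_leNgt ?normr_real ?gtr0_real ?mulr_gt0 ?exprn_gt0//.
  by apply/negP => yf; apply: nex; exists f.
have N0 : 0 < `|y - z| by rewrite (lt_le_trans _ (Pj _ Fz))// mulr_gt0// exprn_gt0.
exists (`|y - z|^-1 *: (y - z)) => [|f Ff].
  by rewrite normrZ normfV normr_id mulVf// gt_eqF.
have -> : `|y - z|^-1 *: (y - z) - f =
    `|y - z|^-1 *: (y - (`|y - z| *: f + z)).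
  rewrite [in RHS](addrC (_ *: f)) opprD addrA [RHS]scalerBr scalerA.
  by rewrite mulVf ?gt_eqF// scale1r.
rewrite normrZ normfV normr_id mulrCA ler_pdivlMl// mulr1.
rewrite (le_trans (ltW yz))// exprS mulrCA ler_pM2l//.
by apply: Pj; exact: Flin.
Qed.

(** Only the last coefficient is controlled, but with a constant that does not
    depend on n: this is why fixed geometric weights suffice below. *)
Lemma riesz_sequence (R : realType) (K : numFieldType)
    (iota : {rmorphism R -> K}) (H : complete_scalars iota)
    (E : normedModType K) : infinite_dimensional E ->
  exists e : nat -> E, (forall n, `|e n| <= 1) /\
    forall (b : nat -> K) n, `|b n| <= 2 * `|\sum_(k < n.+1) b k *: e k|.
Proof.
move=> infE.
have /choice[g gP] (s : seq E) : exists e : E,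
    `|e| = 1 /\ forall f, lspan s f -> 1 <= 2 * `|e - f|.
  have [y sy] := lspan_neqT s infE.
  have [e e1 eP] := riesz_lemma H (closed_lspan H (s := s)) (lspan0 s)
    (fun a u v => @lspan_linear _ _ s a u v) sy.
  by exists e.
(* L n lists the n vectors chosen so far, the latest one first. *)
pose L n := iter n (fun s => g s :: s) [::].
exists (g \o L); split => [n /=|b n]; first by rewrite (gP _).1.
have Lsum m : lspan (L m) (\sum_(k < m) b k *: g (L k)).
  elim: m => [|m IH]; first by rewrite big_ord0.
  by rewrite big_ord_recr/= addrC; exists (b m), (\sum_(k < m) b k *: g (L k)).
rewrite big_ord_recr/=; have [->|b0] := eqVneq (b n) 0.
  by rewrite normr0 mulr_ge0.
rewrite -[leLHS]mulr1 -ler_pdivlMl ?normr_gt0// mulrCA.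
rewrite -normfV -normrZ scalerDr scalerA mulVf// scale1r addrC.
rewrite -[X in _ + X]opprK -scalerN.
by apply: (gP _).2; rewrite scalerN -scaleNr; exact: lspanZ.
Qed.

(** * An injective bounded operator from bounded sequences to E *)

(** The ratio 1/16 is small enough for the tail of the series, multiplied by the
    constant 2 of [riesz_sequence], to be dominated by half of the term before
    it. *)
Definition synthesis (K : numFieldType) (E : normedModType K)
    (e : nat -> E) (b : nat -> K) : E :=
  lim (series (fun k => (b k * 16^-1 ^+ k) *: e k) @ \oo).

(** The geometric bound, in a form that holds for finite blocks: convergence and
    the estimate of the tails both follow from it. *)
Lemma synthesis_block (K : numFieldType) (E : normedModType K)
    (e : nat -> E) (b : nat -> K) (B : K) :
    (forall n, `|e n| <= 1) -> (forall k, `|b k| <= B) ->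
  forall n m, (n <= m)%N ->
  `|\sum_(n <= k < m) (b k * 16^-1 ^+ k) *: e k| <= B * 2 * 16^-1 ^+ n.
Proof.
move=> e1 bB n m nm.
have B0 : 0 <= B by exact: le_trans (normr_ge0 _) (bB 0%N).
(* This sharper bound telescopes when m increases. *)
suff : `|\sum_(n <= k < m) (b k * 16^-1 ^+ k) *: e k|
    <= B * 2 * 16^-1 ^+ n - B * 2 * 16^-1 ^+ m.
  move=> /le_trans; apply; rewrite gerBl.
  by rewrite !mulr_ge0// exprn_ge0// invr_ge0.
elim: m nm => [|m IH].
  by rewrite leqn0 => /eqP->; rewrite big_geq// normr0 subrr.
rewrite leq_eqVlt => /predU1P[->|nm]; first by rewrite big_geq// normr0 subrr.
rewrite big_nat_recr//=; apply: le_trans (ler_normD _ _) _.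
apply: (@le_trans _ _ (B * 2 * 16^-1 ^+ n - B * 2 * 16^-1 ^+ m
  + B * 16^-1 ^+ m)); last first.
  rewrite -addrA lerD2l exprS -subr_ge0.
  set q := 16^-1 ^+ m.
  rewrite (_ : _ - _ = B * q * (7 / 8)); last by field.
  by rewrite !mulr_ge0// ?invr_ge0// exprn_ge0// invr_ge0.
apply: lerD; first exact: IH.
rewrite normrZ normrM normrX (ger0_norm (_ : 0 <= 16^-1)) ?invr_ge0//.
rewrite -[leRHS]mulr1 ler_pM// ?mulr_ge0 ?exprn_ge0 ?invr_ge0//.
by rewrite ler_wpM2r ?exprn_ge0 ?invr_ge0.
Qed.

Lemma sixteenth_expn_near (R : realType) (K : numFieldType)
    (iota : {rmorphism R -> K}) (H : complete_scalars iota) (C e : K) :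
  0 < C -> 0 < e -> \forall n \near \oo, C * 16^-1 ^+ n < e.
Proof.
move=> C0 e0; apply: filterS (half_expn_near H (divr_gt0 e0 C0)) => n ne.
rewrite mulrC -ltr_pdivlMr//; apply: le_lt_trans ne.
by apply: lerXn2r; rewrite ?nnegrE ?invr_ge0// lef_pV2 ?posrE// ler_nat.
Qed.

Lemma synthesis_cvg (R : realType) (K : numFieldType)
    (iota : {rmorphism R -> K}) (H : complete_scalars iota)
    (E : completeNormedModType K) (e : nat -> E) (b : nat -> K) (B : K) :
    (forall n, `|e n| <= 1) -> (forall k, `|b k| <= B) ->
  series (fun k => (b k * 16^-1 ^+ k) *: e k) @ \oo --> synthesis e b.
Proof.
move=> e1 bB; apply: cauchy_cvg; apply/cauchyP => r r0.
have B0 : 0 <= B by exact: le_trans (normr_ge0 _) (bB 0%N).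
have B1 : 0 < B * 2 + 1 by rewrite ltr_wpDl// mulr_ge0.
have [N _ NP] := sixteenth_expn_near H B1 r0.
exists (series (fun k => (b k * 16^-1 ^+ k) *: e k) N); exists N => // n /= Nn.
rewrite -ball_normE /= distrC sub_series_geq//.
apply: le_lt_trans (synthesis_block e1 bB Nn) _.
apply: le_lt_trans (NP N (leqnn N)).
by rewrite ler_wpM2r ?exprn_ge0 ?invr_ge0// lerDl.
Qed.

Lemma synthesis_tail (R : realType) (K : numFieldType)
    (iota : {rmorphism R -> K}) (H : complete_scalars iota)
    (E : completeNormedModType K) (e : nat -> E) (b : nat -> K) (B : K) n :
    (forall n, `|e n| <= 1) -> (forall k, `|b k| <= B) ->
  `|synthesis e b - \sum_(k < n) (b k * 16^-1 ^+ k) *: e k|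
    <= B * 2 * 16^-1 ^+ n.
Proof.
move=> e1 bB; apply/ler_addgt0Pr => r r0.
have /cvgrPdist_le/(_ r r0) near_r := synthesis_cvg H e1 bB.
have [m [/= mr nm]] := filter_ex (filterI near_r (nbhs_infty_ge n)).
set u := fun k => _ in mr; rewrite -(big_mkord xpredT u).
rewrite -[synthesis e b](subrK (series u m)) -addrA addrC.
rewrite sub_series_geq//.
apply: le_trans (ler_normD _ _) _; apply: lerD => //.
exact: synthesis_block.
Qed.

Lemma synthesis_linear (R : realType) (K : numFieldType)
    (iota : {rmorphism R -> K}) (H : complete_scalars iota)
    (E : completeNormedModType K) (e : nat -> E) (a : K) (b c : nat -> K)
    (B C : K) :
    (forall n, `|e n| <= 1) -> (forall k, `|b k| <= B) ->
    (forall k, `|c k| <= C) ->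
  synthesis e (fun k => a * b k + c k) = a *: synthesis e b + synthesis e c.
Proof.
move=> e1 bB cC.
apply/cvg_lim; first exact: norm_hausdorff.
rewrite [X in X @ _ --> _](_ : _ = fun n =>
    a *: series (fun k => (b k * 16^-1 ^+ k) *: e k) n
    + series (fun k => (c k * 16^-1 ^+ k) *: e k) n); last first.
  apply/funext => n; rewrite /series /= scaler_sumr -big_split/=.
  by apply: eq_bigr => k _; rewrite scalerA -scalerDl mulrDl mulrA.
have cvgb := synthesis_cvg H e1 bB.
have cvgc := synthesis_cvg H e1 cC.
exact: (cvgD (cvgZl_tmp cvgb) cvgc).
Qed.

(** The partial sum up to k is minus the tail after k, whose norm is at most
    2 C / 16^(k+1) when all coefficients are bounded by C. Hence
    |b_k| <= 4 C / 16 <= C / 2: any bound on the coefficients can be halved. *)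
Lemma synthesis_inj (R : realType) (K : numFieldType)
    (iota : {rmorphism R -> K}) (H : complete_scalars iota)
    (E : completeNormedModType K) (e : nat -> E) (b : nat -> K) (B : K) :
    (forall n, `|e n| <= 1) ->
    (forall (b : nat -> K) n, `|b n| <= 2 * `|\sum_(k < n.+1) b k *: e k|) ->
    (forall k, `|b k| <= B) ->
  synthesis e b = 0 -> forall k, b k = 0.
Proof.
move=> e1 eP bB b0.
have halve (C : K) : (forall k, `|b k| <= C) -> forall k, `|b k| <= C / 2.
  move=> bC k; have := synthesis_tail H k.+1 e1 bC.
  rewrite b0 sub0r normrN => tail.
  have C0 : 0 <= C by exact: le_trans (normr_ge0 _) (bC 0%N).
  have q0 : 0 < 16^-1 ^+ k :> K by rewrite exprn_gt0 ?invr_gt0.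
  have := eP (fun k => b k * 16^-1 ^+ k) k.
  rewrite normrM (gtr0_norm q0) => /le_trans h.
  rewrite -(ler_pM2r q0); apply: h.
  apply: (@le_trans _ _ (2 * (C * 2 * 16^-1 ^+ k.+1))).
    by rewrite ler_pM2l.
  rewrite exprS -subr_ge0.
  rewrite (_ : _ - _ = C * 16^-1 ^+ k * 4^-1); last by field.
  by rewrite !mulr_ge0 ?invr_ge0// ltW.
have iter_halve j : forall k, `|b k| <= B * 2^-1 ^+ j.
  elim: j => [|j IH]; first by rewrite mulr1.
  by rewrite exprSr mulrA; exact: halve.
move=> k; apply/eqP/contraT; rewrite -normr_gt0 => bk0.
have B0 : 0 < B by exact: lt_le_trans bk0 (bB k).
have [n] := filter_ex (half_expn_near H (divr_gt0 bk0 B0)).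
by rewrite ltr_pdivlMr// mulrC => /(le_lt_trans (iter_halve n k)); rewrite ltxx.
Qed.

(** * The curve of power sequences *)

Definition power_curve (K : numFieldType) (E : normedModType K)
    (e : nat -> E) (z : K) : E :=
  synthesis e (fun k => z ^+ k).

Lemma half_ball_expn (K : numFieldType) (z : K) k :
  `|z| <= 2^-1 -> `|z ^+ k| <= 1.
Proof.
move=> zh; rewrite normrX exprn_ile1//.
by rewrite (le_trans zh)// invf_le1// ler1n.
Qed.

(** Induction on k, from
    z^(k+1) - w^(k+1) = z (z^k - w^k) + (z - w) w^k, where both z and, for
    k > 0, w^k have norm at most 1/2. *)
Lemma expn_contract (K : numFieldType) (z w : K) k :
  `|z| <= 2^-1 -> `|w| <= 2^-1 -> `|z ^+ k - w ^+ k| <= `|z - w|.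
Proof.
move=> zh wh; elim: k => [|[|k] IH]; first by rewrite subrr normr0.
  by rewrite !expr1.
rewrite (_ : _ - _ = z * (z ^+ k.+1 - w ^+ k.+1) + (z - w) * w ^+ k.+1);
  last by rewrite !exprS; ring.
rewrite (le_trans (ler_normD _ _))// (splitr `|z - w|) lerD//.
  by rewrite normrM mulrC ler_pM.
rewrite normrM ler_pM// exprS normrM (le_trans _ wh)// ler_piMr//.
exact: half_ball_expn.
Qed.

Lemma power_curve_lipschitz (R : realType) (K : numFieldType)
    (iota : {rmorphism R -> K}) (H : complete_scalars iota)
    (E : completeNormedModType K) (e : nat -> E) (z w : K) :
    (forall n, `|e n| <= 1) -> `|z| <= 2^-1 -> `|w| <= 2^-1 ->
  `|power_curve e z - power_curve e w| <= 2 * `|z - w|.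
Proof.
move=> e1 zh wh.
rewrite -[X in `|X|]addrC -scaleN1r.
rewrite -(synthesis_linear H (-1) e1 (fun k => half_ball_expn k wh)
  (fun k => half_ball_expn k zh)).
have := @synthesis_tail _ _ _ H _ e (fun k => -1 * w ^+ k + z ^+ k) `|z - w| 0 e1.
rewrite big_ord0 subr0 mulr1 mulrC; apply => k.
by rewrite mulN1r addrC; exact: expn_contract.
Qed.

Lemma synthesis_sum (R : realType) (K : numFieldType)
    (iota : {rmorphism R -> K}) (H : complete_scalars iota)
    (E : completeNormedModType K) (e : nat -> E) n (c : 'I_n -> K)
    (b : 'I_n -> nat -> K) (B : K) :
    (forall n, `|e n| <= 1) -> (forall i k, `|b i k| <= B) ->
  synthesis e (fun k => \sum_(i < n) c i * b i k) =
  \sum_(i < n) c i *: synthesis e (b i).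
Proof.
move=> e1 bB; elim: n => [|n IH] in c b bB *.
  rewrite big_ord0 /synthesis (_ : series _ = fun=> 0).
    by apply/cvg_lim; [exact: norm_hausdorff|exact: cvg_cst].
  by apply/funext => m; rewrite /series/= big1// => k _; rewrite big_ord0 mul0r scale0r.
rewrite big_ord_recl -IH//.
rewrite -(@synthesis_linear _ _ _ H _ _ _ _ _ B (\sum_(i < n) `|c (lift ord0 i)| * B))//.
  by congr synthesis; apply/funext => k; rewrite big_ord_recl.
move=> k; rewrite (le_trans (ler_norm_sum _ _ _))// ler_sum// => i _.
by rewrite normrM ler_wpM2l.
Qed.

(** The Vandermonde matrix of distinct ratios is invertible. *)
Lemma expn_family_free (K : fieldType) n (z c : 'I_n -> K) :
  injective z -> (forall k, \sum_(i < n) c i * z i ^+ k = 0) ->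
  forall i, c i = 0.
Proof.
move=> zinj cz0.
pose V := Vandermonde n (\row_i z i).
have Vunit : V \in unitmx.
  rewrite unitmxE det_Vandermonde unitfE prodf_seq_neq0.
  apply/allP => i _ /=; rewrite prodf_seq_neq0; apply/allP => j _; apply/implyP.
  rewrite !mxE subr_eq0 => ij; apply/eqP => /zinj ji.
  by rewrite ji ltnn in ij.
have Vc : V *m (\col_i c i) = 0.
  apply/matrixP => k j; rewrite !mxE -[RHS](cz0 k).
  by apply: eq_bigr => i _; rewrite !mxE mulrC.
move=> i; have := congr1 (mulmx (invmx V)) Vc.
rewrite mulKmx// mulmx0 => /matrixP/(_ i ord0).
by rewrite !mxE.
Qed.

Lemma power_curve_free (R : realType) (K : numFieldType)
    (iota : {rmorphism R -> K}) (H : complete_scalars iota)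
    (E : completeNormedModType K) (e : nat -> E) n (z c : 'I_n -> K) :
    (forall n, `|e n| <= 1) ->
    (forall (b : nat -> K) n, `|b n| <= 2 * `|\sum_(k < n.+1) b k *: e k|) ->
    (forall i, `|z i| <= 2^-1) -> injective z ->
  \sum_(i < n) c i *: power_curve e (z i) = 0 -> forall i, c i = 0.
Proof.
move=> e1 eP zh zinj.
rewrite -(synthesis_sum H c e1 (fun i k => half_ball_expn k (zh i))).
move=> /(synthesis_inj H e1 eP) cz0; apply: (expn_family_free zinj) => k.
apply: (cz0 (\sum_(i < n) `|c i|)) => {}k.
rewrite (le_trans (ler_norm_sum _ _ _))// ler_sum// => i _.
by rewrite normrM ler_piMr// half_ball_expn.
Qed.

(** * Measurability and cardinality of an arc *)

(** The map r |-> 1 / (1 + exp r) injects the real line into (0,1). *)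
Lemma card_itv01 (R : realType) : ((`]0, 1[%classic : set R) #= [set: R])%card.
Proof.
apply: Cantor_Bernstein; first exact: subset_card_le.
pose f (r : R) := (1 + expR r)^-1.
have fE : (f @` setT #= [set: R])%card.
  apply: inj_card_eq => r s _ _ /invr_inj/addrI; exact: expR_inj.
apply: card_le_trans (subset_card_le (A := f @` setT) _).
  by have := card_eqPle (f @` setT) [set: R]; move=> [/(_ fE) []].
move=> _ [r _ <-] /=.
by rewrite in_itv/= invr_gt0 invf_lt1 ?ltrDl ?addr_gt0 ?expR_gt0.
Qed.

Lemma uncountable_itv01 (R : realType) : ~ countable (`]0, 1[%classic : set R).
Proof.
move=> /countable_lebesgue_measure0; rewrite lebesgue_measure_itv/= lte_fin ltr01.
by rewrite -EFinB subr0 => /eqP; rewrite eqe oner_eq0.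
Qed.

(** Continuity up to the end points makes the closed arc compact, and by
    injectivity the open arc is the closed one without its two end points. *)
Lemma arc_measurable_family (R : realType) (K : numFieldType)
    (E : normedModType K) (x : R -> E) :
  {within `[0, 1], continuous x} -> {in `[0, 1]%classic &, injective x} ->
  [/\ measurable_family x, (family_range x #= [set: R])%card
    & ~ countable (family_range x)].
Proof.
move=> cx xinj.
have sub01 : `]0, 1[%classic `<=` (`[0, 1]%classic : set R).
  exact: subset_itv_oo_cc.
have rangeE : (family_range x #= (`]0, 1[%classic : set R))%card.
  apply: inj_card_eq => s t /set_mem s01 /set_mem t01.
  by apply: xinj; apply/mem_set/sub01.
split; last 2 first.
- exact: card_eq_trans rangeE (card_itv01 R).
- by rewrite (eq_countable rangeE); exact: uncountable_itv01.
split.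
  apply: (@measurability _ _ R (borel E) _ _ (@open E)) => // _ [U oU <-].
  apply: open_measurable_subspace => //.
  by have /continuousP := continuous_subspaceW sub01 cx; exact.
have closed_measurable (A : set E) : closed A -> measurable (A : set (borel E)).
  move=> cA; rewrite -[A]setCK; apply: measurableC.
  by apply: sub_gen_smallest; exact: closed_openC.
have closed1 (y : E) : closed [set y].
  exact: accessible_closed_set1 (hausdorff_accessible (@norm_hausdorff _ E)) _.
have -> : family_range x = x @` `[0, 1] `\` ([set x 0] `|` [set x 1]).
  apply/seteqP; split => [_ [t t01 <-]|_ [[t t01 <-]] nt].
    split; first by exists t => //; exact: sub01.
    have in01 (s : R) : 0 <= s <= 1 -> s \in (`[0, 1]%classic : set R).
      by move=> s01; apply/mem_set; rewrite /= in_itv.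
    have tcc : t \in (`[0, 1]%classic : set R) by exact/mem_set/sub01.
    move: t01; rewrite /= in_itv/= => /andP[t0 t1].
    case=> /= /xinj t_end; move: t0 t1.
      by rewrite t_end ?ltxx// in01// lexx ler01.
    by rewrite t_end ?ltxx// in01// lexx ler01.
  exists t => //; move: t01; rewrite /= !in_itv/= => /andP[t0 t1].
  rewrite !lt_def t0 t1 !andbT; apply/andP; split; apply/eqP => tE; apply: nt.
    by left; rewrite tE.
  by right; rewrite -tE.
apply: measurableD; last by apply: measurableU; exact: closed_measurable.
apply: closed_measurable; apply: compact_closed; first exact: norm_hausdorff.
by apply: continuous_compact => //; exact: segment_compact.
Qed.

(** * The theorem *)

Lemma exists_measurable_free_family (R : realType) (K : numFieldType)
    (iota : {rmorphism R -> K}) (H : complete_scalars iota)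
    (E : completeNormedModType K) :
  infinite_dimensional E ->
  exists x : R -> E,
    [/\ measurable_family x, linearly_independent_family x,
        (family_range x #= [set: R])%card & ~ countable (family_range x)].
Proof.
move=> infE; have [e [e1 eP]] := riesz_sequence H infE.
(* Halving the parameter keeps the ratios in the disk of radius 1/2. *)
pose p (t : R) : K := iota (t / 2).
pose x t := power_curve e (p t).
have p_inj : injective p.
  by move=> s t /fmorph_inj/mulIf; apply; rewrite invr_eq0.
have p_half t : t \in `[0, 1] -> `|p t| <= 2^-1.
  rewrite in_itv/= => /andP[t0 t1].
  rewrite -(rmorph_nat iota) -fmorphV (scalars_norm H) (scalars_le H).
  by rewrite ger0_norm ?divr_ge0// ler_piMl ?invr_ge0.
have xfree n (t : 'I_n -> R) (c : 'I_n -> K) :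
    (forall i, t i \in `[0, 1]) -> injective t ->
    \sum_(i < n) c i *: x (t i) = 0 -> forall i, c i = 0.
  move=> t01 tinj; apply: (power_curve_free H e1 eP) => [i|].
    exact: p_half.
  by move=> i j /p_inj/tinj.
have [|s t /set_mem s01 /set_mem t01 xst|mx cardx ncx] :=
    @arc_measurable_family R K E x.
- apply/subspace_continuousP => t t01; apply/cvgrPdist_le => eps eps0.
  have [r er] := scalars_ge0 H (ltW eps0).
  have r0 : 0 < r by rewrite -(scalars_lt H) rmorph0 -er.
  rewrite near_withinE; near=> s => s01.
  apply: le_trans (power_curve_lipschitz H e1 (p_half t t01) (p_half s s01)) _.
  rewrite /p -rmorphB -mulrBl rmorphM fmorphV rmorph_nat normrM.
  rewrite (ger0_norm (_ : 0 <= 2^-1)) ?invr_ge0// mulrC divfK ?pnatr_eq0//.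
  rewrite (scalars_norm H) er (scalars_le H).
  near: s; have /cvgrPdist_le/(_ r r0) := @cvg_id _ (nbhs t); exact.
(* Injectivity is independence of two vectors, with coefficients 1 and -1. *)
- apply: contrapT => st.
  pose q (i : 'I_2) : R := if i == ord0 then s else t.
  pose c (i : 'I_2) : K := if i == ord0 then 1 else -1.
  have q01 i : q i \in `[0, 1] by rewrite /q; case: ifP.
  have qinj : injective q.
    by case=> [[|[|//]] ?] [[|[|//]] ?]; rewrite /q//= => E0; try exact: val_inj;
      case: st.
  have c0 : \sum_(i < 2) c i *: x (q i) = 0.
    by rewrite !big_ord_recl big_ord0 /q/c/= xst scale1r scaleN1r addr0 subrr.
  by have /eqP := xfree _ q c q01 qinj c0 ord0; rewrite oner_eq0.
exists x; split => // n t t01 tinj c; apply: xfree => // i.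
exact: subset_itv_oo_cc (t01 i).
Unshelve. all: by end_near. Qed.

Lemma complete_scalars_real (R : realType) :
  complete_scalars (idfun : {rmorphism R -> R}).
Proof.
by split => // [k _|u /cauchy_cvg]; [exists k|].
Qed.

(** Convergence of the real and imaginary parts, which inherit the Cauchy
    property because they are 1-Lipschitz. *)
Lemma complex_cauchy_cvg (R : realType) (u : nat -> (R[i] : numFieldType)) :
  cauchy (u @ \oo) -> cvg (u @ \oo).
Proof.
move=> /cauchyP uc.
have part_cvg (f : R[i] -> R) : {morph f : z w / z - w} ->
    (forall z, `|f z|%:C <= `|z|) -> cvg (f \o u @ \oo).
  move=> fB fle; apply: cauchy_cvg; apply/cauchyP => e e0.
  have [|z zP] := uc e%:C; first by rewrite ltcR.
  exists (f z); case: zP => N _ zP; exists N => // n /zP.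
  rewrite -!ball_normE /= => zu.
  by rewrite -ltcR -fB (le_lt_trans (fle _)).
have ReB : {morph @complex.Re R : z w / z - w} by move=> [? ?] [? ?].
have ImB : {morph @complex.Im R : z w / z - w} by move=> [? ?] [? ?].
have Im_le (z : R[i]) : `|complex.Im z|%:C <= `|z|.
  by rewrite normc_def lecR -sqrtr_sqr ler_wsqrtr// lerDr sqr_ge0.
have Re_cvg := part_cvg _ ReB (@normc_ge_Re _).
have Im_cvg := part_cvg _ ImB Im_le.
pose a := lim (@complex.Re R \o u @ \oo).
pose b := lim (@complex.Im R \o u @ \oo).
apply/cvg_ex; exists (a +i* b); apply/cvgrPdist_le => eps eps0.
have epsE : eps = (complex.Re eps)%:C.
  by move: eps0; rewrite ltcE/= => /andP[/eqP + _]; case: (eps) => ? ? /= ->.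
have r0 : 0 < complex.Re eps / 2.
  by rewrite divr_gt0//; move: eps0; rewrite ltcE/= => /andP[].
move/cvgrPdist_le : Re_cvg => /(_ _ r0) near_a.
move/cvgrPdist_le : Im_cvg => /(_ _ r0) near_b.
near=> n.
rewrite [X in `|X|]complexE epsE (splitr (complex.Re eps)) rmorphD.
rewrite (le_trans (ler_normD _ _))// lerD//.
  rewrite normc_def /= expr0n addr0 sqrtr_sqr lecR ReB.
  by near: n.
rewrite normrM normc_def /= expr0n add0r expr1n sqrtr1 mul1r.
rewrite normc_def /= expr0n addr0 sqrtr_sqr lecR ImB.
by near: n.
Unshelve. all: by end_near. Qed.

Lemma complete_scalars_complex (R : realType) :
  complete_scalars (real_complex R : {rmorphism R -> (R[i] : numFieldType)}).
Proof.
split=> [r|k k0|]; last exact: complex_cauchy_cvg.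
  by rewrite normc_def/= expr0n addr0 sqrtr_sqr.
exists (complex.Re k); move: k0; rewrite lecE/= => /andP[/eqP + _].
by case: k => a b /= ->.
Qed.

Theorem theorem1p2 (R : realType) :
  (forall E : completeNormedModType R,
     infinite_dimensional E ->
     exists x : R -> E,
       [/\ measurable_family x,
           linearly_independent_family x,
           (family_range x #= [set: R])%card
         & ~ countable (family_range x)]) /\
  (forall E : completeNormedModType R[i],
     infinite_dimensional E ->
     exists x : R -> E,
       [/\ measurable_family x,
           linearly_independent_family x,
           (family_range x #= [set: R])%card
         & ~ countable (family_range x)]).
Proof.
split=> E.
  exact: (exists_measurable_free_family (complete_scalars_real R)).
exact: (exists_measurable_free_family (complete_scalars_complex R)).
Qed.
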